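(* Let $d \geq 0$ be an integer and let $X$ be a shellable $d$-dimensional simplicial complex on at most $d+3$ vertices. Then $X$ is extendably shellable.
   Context: Simplicial complexes are finite; a facet is an inclusion-maximal face; a complex is pure if all its facets have the same dimension (a face with $m$ elements has dimension $m-1$; the empty set is a face, of dimension $-1$). A pure $d$-dimensional simplicial complex $\Delta$ is shellable if there is an ordering $F_1, F_2, \dots, F_s$ of all of its facets such that for every $k = 2, 3, \dots, s$ the simplicial complex $\left(\bigcup_{i=1}^{k-1} \overline{F_i}\right) \cap \overline{F_k}$ is pure of dimension $d-1$, where $\overline{F}$ denotes the complex of all subsets of $F$. Such an ordering is called a shelling (or shelling order) of $\Delta$. In particular, shellable complexes are pure. A subcomplex of a pure complex $\Delta$ here means a simplicial complex $\Gamma$ whose set of facets is a subset of the set of facets of $\Delta$. A shellable complex $\Delta$ is extendably shellable if any shelling of a subcomplex of $\Delta$ can be extended to a shelling of $\Delta$; that is, whenever $F_1, \dots, F_k$ is a shelling of a subcomplex $\Gamma$ of $\Delta$, the remaining facets of $\Delta$ can be ordered as $F_{k+1}, \dots, F_s$ so that $F_1, \dots, F_s$ is a shelling of $\Delta$. *)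

(* Defs.v *)
From mathcomp Require Import all_boot all_order all_algebra.

Set Implicit Arguments.
Unset Strict Implicit.
Unset Printing Implicit Defensive.

Import GRing.Theory.
Local Open Scope ring_scope.

(* The empty set is required to be a face, so the void family is not a complex.
   Elements of V that are not vertices of the complex are allowed. *)
Definition simplicial_complex (V : finType) (X : {set {set V}}) : Prop :=
  set0 \in X /\ (forall F G : {set V}, F \in X -> G \subset F -> G \in X).

Definition vertices (V : finType) (X : {set {set V}}) : {set V} :=
  [set v | [set v] \in X].

Definition facets (V : finType) (X : {set {set V}}) : {set {set V}} :=
  [set F | maxset (fun G => G \in X) F].

(* Integer-valued, so that the empty face has dimension -1. *)
Definition face_dim (V : finType) (F : {set V}) : int := #|F|%:Z - 1.

(* The maximal dimension of a face, for nonempty X. *)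
Definition complex_dim (V : finType) (X : {set {set V}}) : int :=
  (\max_(F in X) #|F|)%N%:Z - 1.

Definition pure (V : finType) (X : {set {set V}}) : Prop :=
  forall F G : {set V},
    F \in facets X -> G \in facets X -> face_dim F = face_dim G.

(* Facets are numbered from 0; [powerset F] is the complex of all subsets of F. *)
Definition shelling (V : finType) (X : {set {set V}}) (s : seq {set V}) : Prop :=
  [/\ pure X,
      uniq s,
      s =i facets X
    & forall k : nat, (0 < k < size s)%N ->
        let Y := (\bigcup_(F <- take k s) powerset F)
                   :&: powerset (nth set0 s k) in
        pure Y /\ complex_dim Y = complex_dim X - 1].

Definition shellable (V : finType) (X : {set {set V}}) : Prop :=
  exists s : seq {set V}, shelling X s.

Definition subcomplex (V : finType) (Y X : {set {set V}}) : Prop :=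
  simplicial_complex Y /\ facets Y \subset facets X.

Definition extendably_shellable (V : finType) (X : {set {set V}}) : Prop :=
  shellable X /\
  forall (Y : {set {set V}}) (s : seq {set V}),
    subcomplex Y X -> shelling Y s ->
    exists t : seq {set V}, shelling X (s ++ t).

(* Main.v *)
Require Import Defs.
From mathcomp Require Import all_boot all_order all_algebra.
From mathcomp Require Import zify.

(* Let W be the vertex set of X. If |W| <= d+2, distinct facets always meet in
   codimension one, so every order is a shelling. If |W| = d+3, a facet is
   determined by its two-element complement in W; take the pairs that are not
   such complements as the edges of a graph on W. Adding a facet deletes an
   edge xy, and the shelling condition says that the common neighbours of x
   and y form a clique, which keeps the graph chordal. So a shelling of X and
   a partial shelling give nested chordal graphs H and H', and by a lemma of
   Rose, Tarjan and Lueker some edge of H' outside H can be deleted from H' in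
   this way: this is the next facet. *)

Set Implicit Arguments.
Unset Strict Implicit.
Unset Printing Implicit Defensive.

(** * Simplicial vertices and edge deletion in chordal graphs *)

Section ChordalGraphs.

Variable V : finType.
Implicit Types (e : rel V) (S C : {set V}).

Definition clique e C := {in C &, forall a b, e a b}.

Definition simplicial e S s := {in S &, forall a b, e s a -> e s b -> e a b}.

(* Adjacency is taken reflexive. Chordality is expressed by the hereditary
   existence of simplicial vertices instead of by the absence of long induced
   cycles. *)
Definition chordal e :=
  forall S, S != set0 -> exists2 s, s \in S & simplicial e S s.

Definition common_nbrs_clique e S x y :=
  {in S &, forall a b, e x a -> e y a -> e x b -> e y b -> e a b}.

(** Dirac's argument: if a simplicial vertex [s] of [S] lies in [C], induction on [S :\ s] gives a
    simplicial vertex not adjacent to [s]; it is outside [C] and stays simplicial in [S]. If no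
    vertex avoids [s], then [S] is a clique. *)
Lemma simplicial_outside_clique e S C :
    reflexive e -> symmetric e -> chordal e ->
  clique e C -> C \proper S -> exists2 s, s \in S :\: C & simplicial e S s.
Proof.
move=> er es ch; have [n] := ubnP #|S|; elim: n S C => // n IH S C.
rewrite ltnS => leS clC prC; have /properP[/subsetP sCS [w wS wC]] := prC.
have [s sS ss] : exists2 s, s \in S & simplicial e S s.
  by apply: ch; apply/set0Pn; exists w.
have [sC|sC] := boolP (s \in C); last by exists s; rewrite // inE sC.
pose N := [set a in S :\ s | e s a].
have clN : clique e N.
  move=> a b; rewrite !inE => /andP[/andP[_ aS] sa] /andP[/andP[_ bS] sb].
  exact: ss.
have [prN|] := boolP (N \proper S :\ s).
  have [|t] := IH (S :\ s) N _ clN prN.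
    by rewrite (leq_trans _ leS) // [X in _ < X](cardsD1 s) sS.
  rewrite !inE => /andP[+ /andP[ts tS]]; rewrite ts tS /= => nst st.
  exists t.
    rewrite inE tS andbT; apply: contra nst => tC; exact: clC.
  move=> a b aS bS ta tb; apply: st => //; rewrite !inE ?aS ?bS andbT.
    by apply: contra nst => /eqP <-; rewrite es.
  by apply: contra nst => /eqP <-; rewrite es.
rewrite properE negb_and negbK => /orP[/subsetPn[z]|/subsetP sub].
  by rewrite !inE => /andP[->].
have adj_s z : z \in S -> e s z.
  have [-> //|zs zS] := eqVneq z s.
  by have := sub z; rewrite !inE zs zS => /(_ isT).
exists w; first by rewrite inE wC.
by move=> a b aS bS _ _; apply: ss => //; apply: adj_s.
Qed.

(** A simplicial vertex stays simplicial unless it is adjacent to both [x] and [y]. The common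
    neighbours form a clique, so one can be chosen outside it. *)
Lemma chordal_delete e e' x y : reflexive e -> symmetric e -> chordal e ->
    x != y -> e x y -> common_nbrs_clique e setT x y ->
    (forall a b, e' a b = e a b && ([set a; b] != [set x; y])) ->
  chordal e'.
Proof.
move=> er es ch nxy exy cn e'E S S0.
have sub a b : e' a b -> e a b by rewrite e'E => /andP[].
have keep s : simplicial e S s ->
    ~~ [&& x \in S, y \in S, e' s x & e' s y] -> simplicial e' S s.
  move=> ss nxyS a b aS bS sa sb; rewrite e'E (ss a b) ?sub //=.
  apply: contra nxyS => /eqP abE.
  have: (x \in [set a; b]) && (y \in [set a; b]).
    by rewrite abE !inE !eqxx orbT.
  rewrite !inE => /andP[/orP[]/eqP xE /orP[]/eqP yE];
    by rewrite xE yE ?aS ?bS ?sa ?sb.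
have [/andP[xS yS]|nxyS] := boolP ((x \in S) && (y \in S)); last first.
  have [s sS ss] := ch S S0; exists s => //; apply: keep => //.
  by apply: contra nxyS => /and4P[-> ->].
pose A := [set a in S | e x a && e y a].
have clA : clique e A.
  move=> a b; rewrite !inE => /and3P[_ xa ya] /and3P[_ xb yb].
  exact: cn.
have [prA|] := boolP (A \proper S).
  have [s] := simplicial_outside_clique er es ch clA prA.
  rewrite !inE => /andP[nA sS] ss; exists s => //; apply: keep => //.
  apply: contra nA => /and4P[_ _ /sub sx /sub sy].
  by rewrite sS es sx es.
rewrite properE negb_and negbK => /orP[/subsetPn[z]|/subsetP SA].
  by rewrite inE => /andP[->].
(* All of [S] is now a clique for [e], and [x] has lost its neighbour [y]. *)
exists x => //; apply: keep => [a b aS bS _ _|].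
  by apply: clA; apply: SA.
by rewrite [e' x y]e'E eqxx !andbF.
Qed.

(* Rose, Tarjan and Lueker: an edge of [e'] outside [e] whose removal keeps
   [e'] chordal exists at any vertex simplicial in [e] that meets such an
   edge; other simplicial vertices of [e] can be discarded. *)
Lemma exposed_edge e e' S x y : reflexive e -> symmetric e ->
    reflexive e' -> symmetric e' -> chordal e -> chordal e' ->
    subrel e e' -> x \in S -> y \in S -> e' x y -> ~~ e x y ->
  exists u v, [/\ u \in S, v \in S, e' u v, ~~ e u v
    & common_nbrs_clique e' S u v].
Proof.
move=> er es er' es' ch ch' sub.
have [n] := ubnP #|S|; elim: n S x y => // n IH S x y.
rewrite ltnS => leS xS yS xy nxy.
have [v vS sv] : exists2 v, v \in S & simplicial e S v.
  by apply: ch; apply/set0Pn; exists x.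
have [/exists_inP[w wS /andP[vw nvw]]|none] :=
    boolP [exists w in S, e' v w && ~~ e v w].
  (* Common neighbours of [v] and any [u] in [S] lie in [K], so a vertex [u] outside [C] that is
     simplicial in [K] yields the edge [v u]. *)
  pose K := [set a in S | e' v a]; pose C := [set a in S | e v a].
  have clC : clique e' C.
    move=> a b; rewrite !inE => /andP[aS va] /andP[bS vb].
    by apply: sub; apply: sv.
  have prC : C \proper K.
    apply/properP; split; last by exists w; rewrite !inE ?wS // negb_and nvw orbT.
    by apply/subsetP => a; rewrite !inE => /andP[-> /sub].
  have [u] := simplicial_outside_clique er' es' ch' clC prC.
  rewrite !inE => /andP[+ /andP[uS vu]]; rewrite uS /= => nvu su.
  exists v, u; split=> // a b aS bS va ua vb ub.
  by apply: su; rewrite ?inE ?aS ?bS.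
have old w : w \in S -> e' v w -> e v w.
  move=> wS vw; apply: contraR none => nvw.
  by apply/exists_inP; exists w => //; rewrite vw.
have neqv a b : b \in S -> e' a b -> ~~ e a b -> a != v.
  by move=> bS ab; apply: contraNneq => av; rewrite av old -?av.
have xv : x != v by apply: neqv yS xy nxy.
have yv : y != v by apply: neqv xS _ _; rewrite ?(es' y) // es.
have [|||a [b []]] := IH (S :\ v) x y _ _ _ xy nxy; rewrite ?inE ?xv ?yv //.
  by rewrite (leq_trans _ leS) // [X in _ < X](cardsD1 v) vS.
move=> /andP[_ aS] /andP[_ bS] ab nab cn; exists a, b; split=> // p q pS qS.
(* By [old] and simpliciality, [v] as a common neighbour would force [e a b]; so returning from
   [S :\ v] to [S] adds no common neighbour. *)
have nv r : r \in S -> e' a r -> e' b r -> r != v.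
  move=> rS ar br; apply: contraNneq nab => rv; apply: sv => //.
    by rewrite old // -rv es'.
  by rewrite old // -rv es'.
move=> ap bp aq bq; apply: cn => //; rewrite !inE ?pS ?qS andbT; exact: nv.
Qed.

End ChordalGraphs.

(** * Shellings as exchange conditions *)

Section Shellings.

Variable V : finType.
Implicit Types (X Y : {set {set V}}) (F G K : {set V}) (s t T : seq {set V}).

(** The pairwise exchange form of the shelling condition for attaching [F] to [T]. *)
Definition addable T F := forall G, G \in T ->
  exists G', [/\ G' \in T, F :&: G \subset G' & #|F :\: G'| = 1].

Definition shelling_order s :=
  forall k, k < size s -> addable (take k s) (nth set0 s k).

Lemma shelling_order_rcons s F :
  shelling_order (rcons s F) <-> shelling_order s /\ addable s F.
Proof.
split=> [so|[so adF] k].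
  split=> [k ks|].
    have := so k; rewrite size_rcons ltnW // nth_rcons ks -cats1 takel_cat 1?ltnW //.
    exact.
  have := so (size s); rewrite size_rcons ltnSn nth_rcons ltnn eqxx.
  by rewrite -cats1 take_size_cat //; apply.
rewrite size_rcons ltnS nth_rcons -cats1; case: ltngtP => // [ks|->] _.
  by rewrite takel_cat 1?ltnW //; apply: so.
by rewrite take_size_cat.
Qed.

Lemma facet_in X F : F \in facets X -> F \in X.
Proof. by rewrite inE => /maxsetp. Qed.

Lemma facet_exists X F : F \in X -> exists2 G, G \in facets X & F \subset G.
Proof. by move=> /maxset_exists[G mG FG]; exists G; rewrite ?inE. Qed.

Lemma pure_dim_facets X m : X != set0 ->
  (pure X /\ complex_dim X = (m%:Z - 1)%R) <->
  (forall F, F \in facets X -> #|F| = m).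
Proof.
move=> /set0Pn[E0 XE0]; rewrite /complex_dim /pure /face_dim.
have -> : \max_(F in X) #|F| = \max_(F in facets X) #|F|.
  apply/eqP; rewrite eqn_leq; apply/andP; split; apply/bigmax_leqP => F.
    move=> /facet_exists[G GX /subset_leq_card/leq_trans]; apply.
    exact: leq_bigmax_cond.
  by move=> /facet_in; apply: leq_bigmax_cond.
have [F0 F0X _] := facet_exists XE0.
have maxE n : (forall F, F \in facets X -> #|F| = n) ->
    \max_(F in facets X) #|F| = n.
  move=> cn; apply/eqP; rewrite eqn_leq; apply/andP; split.
    by apply/bigmax_leqP => F /cn->.
  by rewrite -(cn F0 F0X); apply: leq_bigmax_cond.
split=> [[pX dX] F FX|cm].
  have cF G : G \in facets X -> #|G| = #|F|.
    by move=> GX; have := pX _ _ GX FX; lia.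
  by move: dX; rewrite (maxE _ cF); lia.
split; last by rewrite (maxE m).
by move=> F G /cm-> /cm->.
Qed.

(** Every face of [Y] lies in some [F :&: G'], which has [m] elements exactly when [F :\: G'] has
    one. An empty difference would give [F = G'], as sizes agree. *)
Lemma attach_complexP T F m : T != [::] -> (forall G, G \in T -> #|G| = m.+1) ->
    #|F| = m.+1 -> F \notin T ->
  let Y := (\bigcup_(G <- T) powerset G) :&: powerset F in
  (forall K, K \in facets Y -> #|K| = m) <-> addable T F.
Proof.
move=> T0 cT cF FT Y.
have inY K : reflect (exists2 G, G \in T & K \subset G :&: F) (K \in Y).
  rewrite inE powersetE bigcup_seq; apply: (iffP andP).
    by case=> /bigcupP[G GT]; rewrite powersetE => KG KF; exists G; rewrite ?subsetI ?KG.
  case=> G GT; rewrite subsetI => /andP[KG ->]; split=> //.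
  by apply/bigcupP; exists G; rewrite ?powersetE.
split=> [cY G GT|ad K KY].
  have [|K KY GFK] := @facet_exists Y (F :&: G).
    by apply/inY; exists G => //; rewrite setIC.
  have /inY[G' G'T] := facet_in KY; rewrite subsetI => /andP[KG' KF].
  exists G'; split=> //; first exact: subset_trans KG'.
  apply/eqP; rewrite eqn_leq card_gt0 setD_eq0; apply/andP; split.
    have := subset_leq_card (setDS F KG').
    by rewrite (cardsD F K) (setIidPr KF) cF (cY K) ?subSnn.
  apply: contraNN FT => FG'; suff -> : F = G' by [].
  by apply/eqP; rewrite eqEcard FG' cF cT /=.
have /inY[G GT KGF] := facet_in KY.
have [G' [G'T GG' c1]] := ad G GT.
have sub : K \subset F :&: G'.
  by apply: subset_trans KGF _; rewrite setIC subsetI subsetIl.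
move: KY; rewrite inE => /maxsetP[_ /(_ (F :&: G')) <- //].
  by move: c1; rewrite cardsD cF; have := subset_leq_card (subsetIl F G'); lia.
by apply/inY; exists G' => //; rewrite setIC.
Qed.

Lemma shellingP X s m : simplicial_complex X ->
    (forall F, F \in facets X -> #|F| = m.+1) ->
  shelling X s <-> [/\ uniq s, s =i facets X & shelling_order s].
Proof.
move=> [X0 _] cX.
have nX : X != set0 by apply/set0Pn; exists set0.
have [pX dX] := (pure_dim_facets m.+1 nX).2 cX.
suff stepP : uniq s -> s =i facets X -> forall k, 0 < k < size s ->
    let Y := (\bigcup_(F <- take k s) powerset F)
               :&: powerset (nth set0 s k) in
    (pure Y /\ complex_dim Y = complex_dim X - 1)%R <->
      addable (take k s) (nth set0 s k).
  split=> [[_ us sX ss]|[us sX ss]]; split=> // k ks; last first.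
    by apply/stepP => //; apply: ss; case/andP: ks.
  (* The first facet carries no shelling condition, and [addable] is vacuous over the empty list. *)
  case: k ks => [|k] ks; first by rewrite take0.
  by apply/stepP => //; apply: ss.
move=> us sX k /andP[k0 ks] Y.
have cs F : F \in s -> #|F| = m.+1 by rewrite sX; apply: cX.
have T0 : take k s != [::].
  by rewrite -size_eq0 size_takel 1?ltnW // -lt0n.
have -> : (complex_dim X - 1 = m%:Z - 1)%R by rewrite dX; lia.
have FT : nth set0 s k \notin take k s.
  by rewrite in_take ?mem_nth // index_uniq // ltnn.
have cT G : G \in take k s -> #|G| = m.+1 by move=> /mem_take/cs.
rewrite -(attach_complexP T0 cT (cs _ (mem_nth _ ks)) FT).
apply: pure_dim_facets; apply/set0Pn; exists set0.
rewrite inE bigcup_seq !powersetE sub0set andbT.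
case: (take k s) T0 => // G T' _; apply/bigcupP; exists G.
  exact: mem_head.
by rewrite powersetE sub0set.
Qed.

End Shellings.

(** * Shelling steps as edge deletions *)

Section CofacetGraph.

Variables (V : finType) (W : {set V}).
Implicit Types (F G : {set V}) (T s : seq {set V}).

(* Facets are encoded by their two-element complements in [W]; the pairs that
   are not such complements are the edges. Loops, and all pairs meeting the
   outside of [W], count as edges. *)
Definition cofacet_graph T : rel V := fun x y => W :\: [set x; y] \notin T.

Definition codim2 T := forall G, G \in T -> G \subset W /\ #|W :\: G| = 2.

Lemma codim2_pair F : F \subset W -> #|W :\: F| = 2 ->
  exists x y, [/\ x != y, x \in W, y \in W & F = W :\: [set x; y]].
Proof.
move=> FW /eqP/cards2P[x [y [nxy E]]]; exists x, y.
have /subsetP sW : [set x; y] \subset W by rewrite -E subsetDl.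
by rewrite -E setDDr setDv set0U (setIidPr FW) !sW ?inE ?eqxx ?orbT.
Qed.

Lemma codim2_neq T x y : codim2 T -> ~~ cofacet_graph T x y ->
  [/\ x != y, x \in W & y \in W].
Proof.
move=> cT; rewrite negbK => /cT[_]; rewrite setDDr setDv set0U => c2.
have le2 : #|[set x; y]| <= 2 by rewrite cards2; case: (x != y).
have /setIidPr/subsetP sW : W :&: [set x; y] = [set x; y].
  by apply/eqP; rewrite eqEcard subsetIr c2.
rewrite !sW ?inE ?eqxx ?orbT //; split=> //.
have := subset_leq_card (subsetIr W [set x; y]).
by rewrite c2 cards2; case: (x != y).
Qed.

Lemma cofacet_graph_refl T : codim2 T -> reflexive (cofacet_graph T).
Proof. by move=> cT x; apply/contraT => /(codim2_neq cT)[/eqP]. Qed.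

Lemma cofacet_graph_sym T : symmetric (cofacet_graph T).
Proof. by move=> x y; rewrite /cofacet_graph setUC. Qed.

Lemma pair_inj x y a b : x != y -> x \in W -> y \in W ->
  W :\: [set a; b] = W :\: [set x; y] -> [set a; b] = [set x; y].
Proof.
move=> nxy xW yW E; apply/esym/eqP; rewrite eqEcard !cards2 nxy /=.
rewrite (leq_trans _ (isT : 1 < 2)) ?andbT; last by case: (_ != _).
by apply/subsetP => z; rewrite !inE => /orP[]/eqP->;
   [have /setP/(_ x) := E | have /setP/(_ y) := E];
   rewrite !inE ?xW ?yW eqxx ?orbT /= ?andbT => /negbFE.
Qed.

(** For [G = W :\: [set a; b]] in [T], a suitable [G'] is the complement of a non-edge joining one
    of [x], [y] to one of [a], [b]. So [addable] says that no non-edge [a b] consists of common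
    neighbours. *)
Lemma addable_clique T x y : codim2 T -> x != y -> x \in W -> y \in W ->
    cofacet_graph T x y ->
  addable T (W :\: [set x; y]) <->
  common_nbrs_clique (cofacet_graph T) setT x y.
Proof.
move=> cT nxy xW yW exy; set e := cofacet_graph T; split.
  move=> ad a b _ _ xa ya xb yb; apply/contraT => /negPn/ad[G' [G'T sub]].
  move=> /eqP/cards1P[z zE].
  have [G'W c2] := cT _ G'T.
  have [p [q [npq pW qW G'E]]] := codim2_pair G'W c2.
  have : z \in [set z] by rewrite inE.
  rewrite -zE => /setDP[zF zG'].
  (* [z] is in the new facet but not in [G'], hence not in [G]. The other point of [W] missing from
     [G'] is then [x] or [y]. *)
  have zab : (z == a) || (z == b).
    apply: contraNT zG' => nz; apply: (subsetP sub).
    by move: zF; rewrite !inE nz => /andP[-> ->].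
  have zW : z \in W by case/setDP: zF.
  have other w : w \in W -> w \notin G' -> w != z -> (w == x) || (w == y).
    move=> wW wG'; apply: contraNT => nw.
    by rewrite -in_set1 -zE !inE wG' nw.
  have bad w : (w == x) || (w == y) -> W :\: [set w; z] \notin T.
    rewrite -/(e w z).
    by case/orP=> /eqP->; case/orP: zab => /eqP->.
  have pG' : p \notin G' by rewrite G'E !inE eqxx.
  have qG' : q \notin G' by rewrite G'E !inE eqxx orbT.
  have : (z == p) || (z == q) by move: zG'; rewrite G'E !inE zW andbT negbK.
  case/orP=> /eqP zp; rewrite zp in other bad.
    have := bad q (other q qW qG' _); rewrite setUC -G'E G'T eq_sym.
    by move=> /(_ npq).
  by have := bad p (other p pW pG' npq); rewrite -G'E G'T.
move=> cn G GT; have [GW c2] := cT _ GT.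
have [a [b [nab aW bW GE]]] := codim2_pair GW c2.
have found w z : (w == x) || (w == y) -> (z == a) || (z == b) -> ~~ e w z ->
    exists G', [/\ G' \in T, (W :\: [set x; y]) :&: G \subset G'
                 & #|(W :\: [set x; y]) :\: G'| = 1].
  move=> wxy zab ewz.
  (* [x] and [y] are adjacent to each other and to themselves. *)
  have zxy : (z == x) || (z == y) = false.
    apply: contraNF ewz; case/orP: wxy => /eqP->; case/orP=> /eqP-> //.
    - exact: cofacet_graph_refl.
    - by rewrite /e cofacet_graph_sym.
    - exact: cofacet_graph_refl.
  have [nwz wW zW] := codim2_neq cT ewz; move: ewz; rewrite negbK => wzT.
  exists (W :\: [set w; z]); split=> //.
    apply/subsetP => u; rewrite GE !inE => /andP[/andP[nu ->] /andP[nu' _]].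
    rewrite andbT negb_or; apply/andP; split.
      by apply: contraNneq nu => ->.
    by apply: contraNneq nu' => ->.
  apply/eqP/cards1P; exists z; apply/setP => u; rewrite !inE.
  have [->|nuz] := eqVneq u z; first by rewrite zxy zW orbT.
  have [->|nuw] := eqVneq u w; first by rewrite wxy andbF.
  by case: (u \in W); rewrite ?andbF.
have [xa|] := boolP (e x a); last by apply: found; rewrite eqxx ?orbT.
have [ya|] := boolP (e y a); last by apply: found; rewrite eqxx ?orbT.
have [xb|] := boolP (e x b); last by apply: found; rewrite eqxx ?orbT.
have [yb|] := boolP (e y b); last by apply: found; rewrite eqxx ?orbT.
have := cn a b (in_setT a) (in_setT b) xa ya xb yb.
by rewrite /e /cofacet_graph -GE GT.
Qed.

(** The empty list gives the complete graph, and each further facet deletes an edge as in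
    [chordal_delete]. *)
Lemma shelling_chordal s : uniq s -> codim2 s -> shelling_order s ->
  chordal (cofacet_graph s).
Proof.
elim/last_ind: s => [_ _ _ S /set0Pn[v vS]|s F IH]; first by exists v.
rewrite rcons_uniq => /andP[Fs us] cs /shelling_order_rcons[ss ad].
have cs' : codim2 s by move=> G Gs; apply: cs; rewrite mem_rcons inE Gs orbT.
have [|FW c2] := cs F; first by rewrite mem_rcons mem_head.
have [x [y [nxy xW yW FE]]] := codim2_pair FW c2.
have exy : cofacet_graph s x y by rewrite /cofacet_graph -FE.
apply: (chordal_delete (cofacet_graph_refl cs') (cofacet_graph_sym s)
          (IH us cs' ss) nxy exy).
  by apply/addable_clique; rewrite // -FE.
move=> a b; rewrite /cofacet_graph mem_rcons inE negb_or andbC FE.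
congr (_ && _); congr (~~ _); apply/eqP/eqP => [|-> //].
exact: pair_inj.
Qed.

(** The graph of [u] lies inside that of [s], strictly because of [F]. The edge from [exposed_edge]
    is a non-edge for [u], hence the complement of a member of [u]. *)
Lemma addable_exists s u F : uniq s -> codim2 s -> shelling_order s ->
    uniq u -> codim2 u -> shelling_order u ->
    {subset s <= u} -> F \in u -> F \notin s ->
  exists G, [/\ G \in u, G \notin s & addable s G].
Proof.
move=> us cs ss uu cu su sub Fu Fs.
have [FW c2] := cu F Fu.
have [x [y [_ _ _ FE]]] := codim2_pair FW c2.
have esub : subrel (cofacet_graph u) (cofacet_graph s).
  by move=> a b; apply: contra => /sub.
have [||p [q [_ _ pq npq cn]]] := exposed_edge (cofacet_graph_refl cu)
  (cofacet_graph_sym u) (cofacet_graph_refl cs) (cofacet_graph_sym s)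
  (shelling_chordal uu cu su) (shelling_chordal us cs ss) esub
  (in_setT x) (in_setT y); rewrite /cofacet_graph -?FE ?negbK //.
have [n_pq pW qW] := codim2_neq cu npq.
exists (W :\: [set p; q]); split=> //; first by rewrite negbK in npq.
exact/addable_clique.
Qed.

End CofacetGraph.

(** * Extending a partial shelling *)

Lemma addable_codim1 (V : finType) (W F : {set V}) (T : seq {set V}) m :
    #|W| <= m.+1 -> (forall G, G \in T -> G \subset W /\ #|G| = m) ->
    F \subset W -> #|F| = m -> F \notin T -> addable T F.
Proof.
(* Distinct [m]-subsets of a set with at most [m.+1] elements differ by one exchange, so [G] itself
   is the witness. *)
move=> cW cT FW cF FT G GT; exists G; split=> //; first exact: subsetIr.
have [GW cG] := cT G GT; apply/eqP; rewrite eqn_leq card_gt0 setD_eq0.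
apply/andP; split.
  by have := subset_leq_card (setSD G FW); rewrite (cardsD W) (setIidPr GW); lia.
apply: contraNN FT => FG; suff -> : F = G by [].
by apply/eqP; rewrite eqEcard FG cF cG /=.
Qed.

Theorem theorem1p1 (V : finType) (d : nat) (X : {set {set V}})
    (hX : simplicial_complex X) (hshell : shellable X)
    (hdim : complex_dim X = Posz d) (hvert : (#|vertices X| <= d + 3)%N) :
  extendably_shellable X.
Proof.
split=> // Y s [hY subYX] shY.
have [u shX] := hshell.
have cX : forall F, F \in facets X -> #|F| = d.+1.
  have [pX _ _ _] := shX.
  apply/pure_dim_facets; first by apply/set0Pn; exists set0; case: hX.
  by split; rewrite // hdim; lia.
have cY F : F \in facets Y -> #|F| = d.+1 by move=> /(subsetP subYX)/cX.
have /(shellingP _ hX cX)[uu uX su] := shX.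
have /(shellingP _ hY cY)[us sY ss] := shY.
pose W := vertices X.
have subW F : F \in facets X -> F \subset W.
  move=> /facet_in FX; apply/subsetP => v vF.
  by rewrite inE; apply: hX.2 FX _; rewrite sub1set.
have step t : uniq t -> shelling_order t -> {subset t <= u} ->
    forall F, F \in u -> F \notin t ->
  exists G, [/\ G \in u, G \notin t & addable t G].
  move=> ut st sub F Fu Ft.
  have [cW|cW] := leqP #|W| d.+2.
    exists F; split=> //; apply: (addable_codim1 cW) => //.
    - by move=> G /sub; rewrite uX => GX; split; [apply: subW|apply: cX].
    - by apply: subW; rewrite -uX.
    - by apply: cX; rewrite -uX.
  (* Now [W] has exactly [d + 3] elements, and facets have [d.+1]. *)
  have cu : codim2 W u.
    move=> G; rewrite uX => GX; split; first exact: subW.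
    rewrite cardsD (setIidPr (subW _ GX)) (cX _ GX).
    by move: hvert; rewrite -/W; lia.
  by apply: (@addable_exists _ W t u F) => // G /sub/cu.
(* Induction on the number of missing facets; [step] supplies the next one. *)
have [n] := ubnP (size u - size s).
have: {subset s <= u} by move=> F; rewrite uX sY; apply: (subsetP subYX).
move: us ss {shY sY}; elim: n s => // n IH s us ss sub le_n.
have [all_u|] := boolP (all [in s] u).
  exists [::]; rewrite cats0; apply/(shellingP _ hX cX); split=> // F.
  by rewrite -uX; apply/idP/idP => [/sub|]; last exact: (allP all_u).
move=> /allPn[F Fu Fs]; have [G [Gu Gs ad]] := step s us ss sub F Fu Fs.
have sub' : {subset rcons s G <= u}.
  by move=> K; rewrite mem_rcons inE => /orP[/eqP->|/sub].
have us' : uniq (rcons s G) by rewrite rcons_uniq Gs.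
have := uniq_leq_size us' sub'; rewrite size_rcons => lt_su.
have [||t] := IH (rcons s G) us' _ sub' _.
- exact/shelling_order_rcons.
- by rewrite size_rcons -ltnS (leq_trans _ le_n) // ltnS ltn_sub2l.
by rewrite cat_rcons => ?; exists (G :: t).
Qed.
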